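(* Let $A^s$, $G$, the interior/exterior splitting, and the matrices $R$, $S_I$, $S$ be as described in the context, with $A^s_{II}=S_I^TA^sS_I$ invertible. Let $$P_\star=\bigl(I-S(S^TA^sS)^{-1}S^TA^s\bigr)R^T,\qquad P_{\mathrm{app}}=\bigl(I-S_I(A^s_{II})^{-1}S_I^TA^s\bigr)R^T,$$ and set $Q_\star:=P_\star R$ and $Q_{\mathrm{app}}:=P_{\mathrm{app}}R$. Assume that $Q_\star$ satisfies the approximate harmonic property, i.e., there exists $\eta_\star\ge 1$ such that $$\|Q_\star e\|_{A^s}\le\sqrt{\eta_\star}\,\|e\|_{A^s}\qquad\text{for all } e\in\mathbb{R}^n .$$ Then $Q_{\mathrm{app}}$ also satisfies the approximate harmonic property: there exists $\eta_{\mathrm{app}}\ge 1$ such that $$\|Q_{\mathrm{app}}e\|_{A^s}\le\sqrt{\eta_{\mathrm{app}}}\,\|e\|_{A^s}\qquad\text{for all } e\in\mathbb{R}^n .$$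
   Context: Setting. $A^s\in\mathbb{R}^{n\times n}$ is symmetric positive semidefinite (the unshifted curl-curl stiffness matrix of a lowest-order Nédélec edge discretization, with rows and columns indexed by the oriented edge degrees of freedom). $G\in\mathbb{R}^{n\times m}$ is the discrete gradient from nodal to edge degrees of freedom: a signed incidence matrix with entries in $\{0,1,-1\}$, rows indexed by edges and columns by nodes. They satisfy the exactness relation $\ker(A^s)=\mathrm{range}(G)$. The seminorm is $\|e\|_{A^s}=(e^TA^se)^{1/2}$. Interior/exterior splitting. The index set $\{1,\dots,n\}$ is a disjoint union $I\cup E$ (interior and exterior degrees of freedom), and $E$ is partitioned into disjoint pairs of edges $\{a,b\}$, the two edges of each pair meeting at a node associated with that pair. For each pair with associated node $k$, the $k$-th column of $G$ has nonzero entries $G_{ak},G_{bk}\in\{1,-1\}$, and its restriction to $E$ is supported exactly on $\{a,b\}$ (its entries on $I$ are unrestricted). Vectors are ordered with interior indices first, and $A^s$ is written in blocks $A^s_{II},A^s_{IE},A^s_{EI},A^s_{EE}$. Coarse and fine variables. $S_E\in\mathbb{R}^{|E|\times|E|/2}$ has one column per pair, with entries $G_{ak}/\sqrt2$ at $a$, $G_{bk}/\sqrt2$ at $b$, and zero elsewhere. $R_E\in\mathbb{R}^{(|E|/2)\times|E|}$ has one row per pair, supported on $\{a,b\}$, of unit length with entries $\pm1/\sqrt2$, orthogonal to the corresponding column of $S_E$. The $n\times|I|$ matrix $S_I$ consists of the Euclidean basis vectors $\{\mathbf e_i:i\in I\}$. Set $$R=\begin{bmatrix}0&R_E\end{bmatrix},\qquad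 S=\left[\,S_I\;\;\begin{bmatrix}0\\S_E\end{bmatrix}\right],$$ so that $RS=0$, $RR^T=I$, $S^TS=I$, and $R_E^TR_E+S_ES_E^T=I$. The matrix $P_\star$ is the ideal interpolation associated with $R$ and $S$, and $P_{\mathrm{app}}$ is its sparse approximation obtained by retaining only $S_I$ in place of $S$.
   Formalization: The inverse of S^T A^s S in P_star is replaced by an arbitrary generalized inverse X (M X M = M), because S^T A^s S is singular whenever there is an exterior pair: the gradient column G e_k lies in range(S) and in ker(A^s). *)

(* Defs.v *)
From HB Require Import structures.
From mathcomp Require Import all_boot all_order all_algebra.
From mathcomp Require Import reals.

Set Implicit Arguments.
Unset Strict Implicit.
Unset Printing Implicit Defensive.

Import Order.TTheory GRing.Theory Num.Theory.
Local Open Scope ring_scope.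

(* Degrees of freedom are indexed by 'I_(ni + ne), the ni interior ones first
   and then the ne exterior ones; the p pairs of exterior edges are indexed by
   'I_p. *)

Definition seminorm (F : realType) (n : nat) (A : 'M[F]_n) (e : 'cV[F]_n) : F :=
  Num.sqrt ((e^T *m A *m e) 0 0).

Definition sym_psd (F : realType) (n : nat) (A : 'M[F]_n) : Prop :=
  A^T = A /\ forall x : 'cV[F]_n, 0 <= (x^T *m A *m x) 0 0.

Definition exact_seq (F : realType) (n m : nat)
    (A : 'M[F]_n) (G : 'M[F]_(n, m)) : Prop :=
  forall x : 'cV[F]_n, A *m x = 0 <-> exists y : 'cV[F]_m, x = G *m y.

(* "At most one" rather than "exactly one" endpoint of each sign, so that nodes
   removed by essential boundary conditions are allowed. *)
Definition signed_incidence (F : realType) (n m : nat)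
    (G : 'M[F]_(n, m)) : Prop :=
  (forall i k, [\/ G i k = 0, G i k = 1 | G i k = -1]) /\
  (forall i k l, G i k = G i l -> G i k != 0 -> k = l).

(* The pairs {a j, b j}, j < p, are disjoint two-element sets covering 'I_ne;
   in particular ne = 2 p. *)
Definition pair_partition (ne p : nat) (a b : 'I_p -> 'I_ne) : Prop :=
  bijective (fun x : 'I_p + 'I_p => match x with inl j => a j | inr j => b j end).

Definition pair_nodes (F : realType) (ni ne m p : nat)
    (G : 'M[F]_(ni + ne, m)) (a b : 'I_p -> 'I_ne) (node : 'I_p -> 'I_m) : Prop :=
  forall (j : 'I_p) (i : 'I_ne),
    G (rshift ni i) (node j) != 0 <-> i = a j \/ i = b j.

Section CoarseFine.
Variables (F : realType) (ni ne m p : nat).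
Implicit Types (A : 'M[F]_(ni + ne)) (G : 'M[F]_(ni + ne, m)).
Implicit Types (a b : 'I_p -> 'I_ne) (node : 'I_p -> 'I_m).

Definition S_E G a b node : 'M[F]_(ne, p) :=
  \matrix_(i, j) (if (i == a j) || (i == b j)
                  then G (rshift ni i) (node j) / Num.sqrt 2 else 0).

(* R_E is determined only up to the sign of each row. *)
Definition is_R_E G a b node (RE : 'M[F]_(p, ne)) : Prop :=
  forall j : 'I_p,
    [/\ forall i, i != a j -> i != b j -> RE j i = 0,
        forall i, i = a j \/ i = b j ->
          RE j i = 1 / Num.sqrt 2 \/ RE j i = - (1 / Num.sqrt 2),
        (row j RE *m (row j RE)^T) 0 0 = 1 &
        (row j RE *m col j (S_E G a b node)) 0 0 = 0].

Definition Rmat (RE : 'M[F]_(p, ne)) : 'M[F]_(p, ni + ne) := row_mx 0 RE.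

Definition S_I : 'M[F]_(ni + ne, ni) := col_mx 1%:M 0.

Definition Smat G a b node : 'M[F]_(ni + ne, ni + p) :=
  row_mx S_I (col_mx 0 (S_E G a b node)).

Definition A_II A : 'M[F]_ni := ulsubmx A.

Lemma A_IIE A : A_II A = S_I^T *m A *m S_I.
Proof.
rewrite /A_II /S_I -{2}[A]submxK tr_col_mx trmx1 trmx0 mul_row_block.
by rewrite !mul1mx !mul0mx !addr0 mul_row_col mulmx1 mulmx0 addr0.
Qed.

End CoarseFine.

(* For a pair with node k, the column G e_k lies in range(S) and in ker(A), so
   S^T A S is singular as soon as there is a pair: the inverse in the formula
   for the ideal interpolation can only be a generalized one. Any solution X of
   M X M = M is allowed. This is the usual inverse if M is invertible
   (gen_inverse_unit), the Moore-Penrose inverse is an instance, and the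
   seminorm of P_star v does not depend on the choice of X. *)
Definition gen_inverse (F : realType) (n : nat) (M X : 'M[F]_n) : Prop :=
  M *m X *m M = M.

Lemma gen_inverse_unit (F : realType) (n : nat) (M X : 'M[F]_n) :
  M \in unitmx -> gen_inverse M X <-> X = invmx M.
Proof.
move=> uM; split=> [MXM | ->]; last by rewrite /gen_inverse mulmxV ?mul1mx.
have MX1 : M *m X = 1%:M.
  by rewrite -[LHS](mulmxK uM) MXM mulmxV.
by rewrite -[X](mulKmx uM) MX1 mulmx1.
Qed.

Section Interpolation.
Variables (F : realType) (ni ne m p : nat).
Variables (A : 'M[F]_(ni + ne)).

Definition P_star (R : 'M[F]_(p, ni + ne)) (S : 'M[F]_(ni + ne, ni + p))
    (X : 'M[F]_(ni + p)) : 'M[F]_(ni + ne, p) :=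
  (1%:M - S *m X *m S^T *m A) *m R^T.

Definition P_app (R : 'M[F]_(p, ni + ne)) : 'M[F]_(ni + ne, p) :=
  (1%:M - S_I F ni ne *m invmx (A_II A) *m (S_I F ni ne)^T *m A) *m R^T.

End Interpolation.

Definition approx_harmonic (F : realType) (n : nat) (A Q : 'M[F]_n) : Prop :=
  exists eta : F, 1 <= eta /\
    forall e : 'cV[F]_n, seminorm A (Q *m e) <= Num.sqrt eta * seminorm A e.

(* Main.v *)
(* Let Pi be the A-orthogonal projector onto the interior coordinates. Each
   column of S_E, extended by zero, differs from a multiple of a gradient column
   G e_k by an interior vector; since A G = 0, I - Pi maps it into ker A. As
   R^T R = I - S S^T, it follows that A Q_app = A (I - Pi), and I - Pi is
   nonexpansive in the A-seminorm, so eta_app = 1 works. *)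
Require Import Defs.
From HB Require Import structures.
From mathcomp Require Import all_boot all_order all_algebra.
From mathcomp Require Import reals.
From mathcomp Require Import ring.
Import Order.TTheory GRing.Theory Num.Theory.
Set Implicit Arguments.
Unset Strict Implicit.
Unset Printing Implicit Defensive.
Local Open Scope ring_scope.

Lemma exact_seq_mul0 (F : realType) (n m : nat) (A : 'M[F]_n)
    (G : 'M[F]_(n, m)) : exact_seq A G -> A *m G = 0.
Proof.
move=> hker; apply/matrixP=> i k.
have /hker/matrixP/(_ i 0) : exists y, G *m delta_mx k 0 = G *m y :> 'cV_n.
  by exists (delta_mx k 0).
by rewrite mulmxA -colE !mxE.
Qed.

Section ComplementaryProjector.
Variables (F : fieldType) (n k : nat) (A : 'M[F]_n) (S : 'M[F]_(n, k)).
Hypothesis symA : A^T = A.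
Hypothesis unitSAS : S^T *m A *m S \in unitmx.

(** The [A]-orthogonal projector onto the range of [S]. Only the Gram matrix of [S] is inverted, so
    [A] itself may be singular. *)
Definition aproj : 'M[F]_n := S *m invmx (S^T *m A *m S) *m S^T *m A.

Lemma aproj_id : aproj *m S = S.
Proof. by rewrite /aproj -!mulmxA [S^T *m _]mulmxA mulVmx // mulmx1. Qed.

Lemma aproj_idem : aproj *m aproj = aproj.
Proof. by rewrite {2}/aproj !mulmxA aproj_id. Qed.

Lemma aproj_selfadj : aproj^T *m A = A *m aproj.
Proof. by rewrite /aproj !trmx_mul trmx_inv !trmx_mul !trmxK symA !mulmxA. Qed.

(** Pythagoras: idempotence and [A]-self-adjointness make the cross terms collapse. *)
Lemma aproj_compl_gram :
  (1%:M - aproj)^T *m A *m (1%:M - aproj) = A - aproj^T *m A *m aproj.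
Proof.
rewrite [(_ - _)^T]linearB /= trmx1 mulmxBl mul1mx aproj_selfadj mulmxBr mulmx1.
by rewrite mulmxBl -mulmxA aproj_idem subrr subr0.
Qed.

End ComplementaryProjector.

(** The squared seminorms differ by that of [C *m e], which is nonnegative. *)
Lemma seminorm_gram_le (F : realType) (n : nat) (A B C : 'M[F]_n)
    (e : 'cV[F]_n) :
  sym_psd A -> B^T *m A *m B = A - C^T *m A *m C ->
  seminorm A (B *m e) <= seminorm A e.
Proof.
move=> [_ psdA] gram; apply: ler_wsqrtr.
have -> : (B *m e)^T *m A *m (B *m e) = e^T *m (B^T *m A *m B) *m e.
  by rewrite trmx_mul !mulmxA.
have := psdA (C *m e); rewrite gram mulmxBr mulmxBl trmx_mul !mulmxA !mxE.
by rewrite gerBl.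
Qed.

Section CoarseFine.
Variables (F : realType) (ni ne m p : nat) (G : 'M[F]_(ni + ne, m)).
Variables (a b : 'I_p -> 'I_ne) (node : 'I_p -> 'I_m) (RE : 'M[F]_(p, ne)).
Hypothesis hG : signed_incidence G.
Hypothesis hpairs : pair_partition a b.
Hypothesis hnodes : pair_nodes G a b node.
Hypothesis hRE : is_R_E G a b node RE.

(** On exterior edges outside the pair the column of [G] already vanishes, so it agrees with the
    zero branch of [S_E]. *)
Lemma S_E_colsub :
  S_E G a b node = (Num.sqrt 2)^-1 *: colsub node (dsubmx G).
Proof.
apply/matrixP=> i j; rewrite !mxE mulrC; case: ifPn => // ij.
apply/esym/eqP; rewrite mulf_eq0; apply/orP; right; apply: contraNT ij.
by move/hnodes => [] ->; rewrite eqxx ?orbT.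
Qed.

Lemma pair_neq j : a j != b j.
Proof.
by apply/eqP=> abj; have := @bij_inj _ _ _ hpairs (inl j) (inr j) abj.
Qed.

Lemma pair_unique i j j' :
  i = a j \/ i = b j -> i = a j' \/ i = b j' -> j = j'.
Proof.
have inj := @bij_inj _ _ _ hpairs.
by case=> -> [] e;
  [have := inj (inl j) (inl j') e | have := inj (inl j) (inr j') e
  |have := inj (inr j) (inl j') e | have := inj (inr j) (inr j') e] => // -[].
Qed.

Lemma pair_cover i : exists j, i = a j \/ i = b j.
Proof.
case: hpairs => g _ /(_ i); case: (g i) => j <-; exists j; by [left|right].
Qed.

Lemma R_E_sqr i j : i = a j \/ i = b j -> RE j i * RE j i = 2^-1.
Proof.
move=> ij; case: (hRE j) => _ /(_ i ij) REji _ _.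
by case: REji => ->; rewrite ?mulrNN mul1r -invfM -expr2 sqr_sqrtr.
Qed.

Lemma S_E_sqr i j : i = a j \/ i = b j ->
  S_E G a b node i j * S_E G a b node i j = 2^-1.
Proof.
move=> ij; have /(_ ij)/eqP Gn0 := (hnodes j i).2.
rewrite S_E_colsub !mxE mulrACA -invfM -expr2 sqr_sqrtr //.
by case: hG => /(_ (rshift ni i) (node j)) [] // -> _;
  rewrite ?mulrNN !mulr1.
Qed.

Lemma S_E_out i j : i != a j -> i != b j -> S_E G a b node i j = 0.
Proof. by rewrite mxE => /negPf-> /negPf->. Qed.

Lemma R_E_out i j : i != a j -> i != b j -> RE j i = 0.
Proof. by case: (hRE j) => out _ _ _; apply: out. Qed.

Lemma pair_orthogonal j :
  RE j (a j) * S_E G a b node (a j) j + RE j (b j) * S_E G a b node (b j) j = 0.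
Proof.
case: (hRE j) => _ _ _; rewrite [(_ *m _) 0 0]mxE.
rewrite (bigD1 (a j)) //= (bigD1 (b j)) /=; last by rewrite eq_sym pair_neq.
rewrite big1 ?addr0 => [|i /andP[ia ib]].
  by rewrite ![row _ _ _ _]mxE ![col _ _ _ _]mxE.
by rewrite [row _ _ _ _]mxE R_E_out // mul0r.
Qed.

(* For a 2 x 2 matrix with entries of equal modulus, orthogonality of the rows
   is equivalent to orthogonality of the columns. *)
Lemma pair_co_orthogonal j :
  RE j (a j) * RE j (b j) +
  S_E G a b node (a j) j * S_E G a b node (b j) j = 0.
Proof.
have := pair_orthogonal j.
have := R_E_sqr (or_intror (erefl (b j))).
have := S_E_sqr (or_introl (erefl (a j))).
move: (RE j (a j)) (RE j (b j)) (S_E _ _ _ _ (a j) j) (S_E _ _ _ _ (b j) j).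
move=> ra rb sa sb saE rbE orth.
have h : 2^-1 * (ra * rb + sa * sb) = 0.
  (* A combination of [saE], [rbE] and [orth]; it avoids dividing by an entry. *)
  have -> : 2^-1 * (ra * rb + sa * sb) =
    (2^-1 - sa * sa) * (ra * rb) + (2^-1 - rb * rb) * (sa * sb)
    + rb * sa * (ra * sa + rb * sb) by ring.
  by rewrite saE rbE orth subrr !mul0r mulr0 !addr0.
by move/eqP: h; rewrite mulf_eq0 invr_eq0 pnatr_eq0 /= => /eqP.
Qed.

(** Only the pair [j] containing [i] contributes to row [i]: it gives 1/2 + 1/2 on the diagonal and
    cancels at the partner edge by [pair_co_orthogonal]. *)
Lemma R_E_S_E_complete :
  RE^T *m RE + S_E G a b node *m (S_E G a b node)^T = 1%:M.
Proof.
apply/matrixP=> i i'; rewrite [LHS]mxE ![(_ *m _) i i']mxE -big_split /=.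
have [j ij] := pair_cover i.
rewrite (bigD1 j) //= big1 ?addr0 => [|j' nj'].
  rewrite ![trmx _ _ _]mxE [RHS]mxE.
  have [<-|nii'] := eqVneq i i'.
    rewrite (R_E_sqr ij) (S_E_sqr ij) -mulr2n.
    by rewrite -(mulr_natr 2^-1) mulVf ?pnatr_eq0.
  have [i'a|i'a] := eqVneq i' (a j).
    case: ij nii' => ->; first by rewrite i'a eqxx.
    by rewrite i'a mulrC [_ * S_E _ _ _ _ _ _]mulrC pair_co_orthogonal.
  have [i'b|i'b] := eqVneq i' (b j).
    case: ij nii' => ->; last by rewrite i'b eqxx.
    by rewrite i'b pair_co_orthogonal.
  by rewrite (R_E_out i'a i'b) (S_E_out i'a i'b) !mulr0 addr0.
have ia : i != a j'.
  by apply: contraNneq nj' => e; apply/eqP/esym/(pair_unique ij); left.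
have ib : i != b j'.
  by apply: contraNneq nj' => e; apply/eqP/esym/(pair_unique ij); right.
by rewrite [trmx _ _ _]mxE R_E_out // S_E_out // !mul0r addr0.
Qed.

Definition S_E_ext : 'M[F]_(ni + ne, p) := col_mx 0 (S_E G a b node).

(** The two column blocks of [S] are kept apart because [I - Pi] annihilates the first, but sends
    the second only into the kernel of [A]. *)
Lemma Rmat_gram :
  (Rmat ni RE)^T *m Rmat ni RE =
  1%:M - S_I F ni ne *m (S_I F ni ne)^T - S_E_ext *m S_E_ext^T.
Proof.
rewrite /Rmat /S_I /S_E_ext tr_row_mx !tr_col_mx !mul_col_row.
rewrite !trmx1 !trmx0 !mul0mx !mulmx0 mulmx1.
apply/eqP; rewrite eq_sym subr_eq subr_eq !add_block_mx !addr0 !add0r.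
by rewrite R_E_S_E_complete scalar_mx_block.
Qed.

(** A gradient column may be nonzero on interior edges; subtracting that part, a combination of the
    columns of [S_I], leaves exactly [S_E]. *)
Lemma S_E_ext_grad :
  S_E_ext = (Num.sqrt 2)^-1 *: colsub node G
            - S_I F ni ne *m ((Num.sqrt 2)^-1 *: colsub node (usubmx G)).
Proof.
apply/eqP; rewrite /S_E_ext /S_I S_E_colsub mul_col_mx mul1mx mul0mx.
rewrite eq_sym subr_eq add_col_mx add0r addr0 -scale_col_mx
        -[in X in X == _](vsubmxK G).
apply/eqP; congr (_ *: _); apply/matrixP=> i j; rewrite !mxE.
by case: splitP => i' _; rewrite !mxE.
Qed.

End CoarseFine.

Theorem theorem3p2 (F : realType) (ni ne m p : nat)
    (As : 'M[F]_(ni + ne)) (G : 'M[F]_(ni + ne, m))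
    (a b : 'I_p -> 'I_ne) (node : 'I_p -> 'I_m)
    (RE : 'M[F]_(p, ne)) (X : 'M[F]_(ni + p))
    (hAs : sym_psd As)
    (hG : signed_incidence G)
    (hker : exact_seq As G)
    (hpairs : pair_partition a b)
    (hnodes : pair_nodes G a b node)
    (hRE : is_R_E G a b node RE)
    (hII : A_II As \in unitmx)
    (hX : gen_inverse ((Smat G a b node)^T *m As *m Smat G a b node) X)
    (hstar : approx_harmonic As
       (P_star As (Rmat ni RE) (Smat G a b node) X *m Rmat ni RE)) :
  approx_harmonic As (P_app As (Rmat ni RE) *m Rmat ni RE).
Proof.
have [symA _] := hAs.
set SI := S_I F ni ne; set B := 1%:M - aproj As SI.
have unitS : SI^T *m As *m SI \in unitmx by rewrite -A_IIE.
have BSI : B *m SI = 0 by rewrite mulmxBl mul1mx aproj_id // subrr.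
(* Moving [B] across [As] lets [As] act directly on the gradient columns. *)
have AB : As *m B = B^T *m As.
  by rewrite mulmxBr [(_ - _)^T]linearB /= trmx1 mulmxBl mulmx1 mul1mx
             aproj_selfadj.
have ABSE : As *m B *m S_E_ext G a b node = 0.
  rewrite (S_E_ext_grad hnodes) mulmxBr (mulmxA _ SI) -(mulmxA As B SI).
  rewrite BSI mulmx0 mul0mx subr0 AB -mulmxA -scalemxAr mulmx_colsub
          (exact_seq_mul0 hker).
  (* Here the zero matrix is read as a constant matrix, which column selection preserves. *)
  by rewrite [colsub _ _](mxsub_const _ _ 0) scaler0 mulmx0.
set Q := P_app As (Rmat ni RE) *m Rmat ni RE.
have QE : Q = B - B *m S_E_ext G a b node *m (S_E_ext G a b node)^T.
  have -> : Q = B *m ((Rmat ni RE)^T *m Rmat ni RE).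
    by rewrite mulmxA /B /aproj -A_IIE.
  rewrite (Rmat_gram hG hpairs hnodes hRE) 2!(mulmxBr B) mulmx1.
  by rewrite (mulmxA B SI) BSI mul0mx subr0 mulmxA.
have AQ : As *m Q = As *m B.
  by rewrite QE mulmxBr !mulmxA ABSE mul0mx subr0.
exists 1; split=> // e; rewrite sqrtr1 mul1r.
apply: (seminorm_gram_le (C := aproj As SI)) => //.
(* By symmetry of [As], the Gram matrix of [Q] depends only on [As *m Q]: using [AQ] on each side
   turns it into that of [B]. *)
rewrite -(aproj_compl_gram symA unitS) -/B -[in LHS]symA -trmx_mul AQ.
by rewrite trmx_mul symA -!mulmxA AQ.
Qed.
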